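(* Let $R$ be an $F$-injective $\mathbb{N}$-graded ring, with $R_0$ an $F$-finite field of characteristic $p>0$. Let $\mathfrak{m}$ be the homogeneous maximal ideal of $R$. Then $c_i(\mathfrak{m}) \leqslant -a_i(R)$ for each $i$. In particular, if $R$ is $F$-pure, then one has the inequality $\mathrm{fpt}(\mathfrak{m}) \leqslant -a_i(R)$ for every integer $i$.
   Context: For each $i$, $a_i(R)=\max\{n\in\mathbb{Z}\mid[H^i_{\mathfrak{m}}(R)]_n\neq 0\}$, with $a_i(R)=-\infty$ if $H^i_{\mathfrak{m}}(R)=0$. For a ring $R$ of characteristic $p>0$, $F^e_*R$ denotes $R$ as an abelian group (elements written $F^e_*x$) with $R$-module structure $r\cdot F^e_*x=F^e_*(r^{p^e}x)$. $R$ is $F$-finite if $F_*R$ is a finitely generated $R$-module. An $F$-finite reduced local ring $(A,\mathfrak{n})$ is $F$-injective if the Frobenius-induced map $H^i_{\mathfrak{n}}(A)\to H^i_{\mathfrak{n}}(A)$ is injective for each $i$; an $F$-finite reduced ring is $F$-injective if all its localizations at maximal ideals are. An $F$-finite reduced ring $R$ is $F$-pure if the Frobenius map $R\to F_*R$ splits $R$-linearly. Let $F^e_{H^i_{\mathfrak{m}}(R)}$ be the map on $H^i_{\mathfrak{m}}(R)$ induced by the $e$-th iterated Frobenius. For real $t\geqslant 0$, let $0^{F\sharp\mathfrak{m}^t}_{H^i_{\mathfrak{m}}(R)}$ be the submodule of all $z\in H^i_{\mathfrak{m}}(R)$ such that $\mathfrak{m}^{\lceil t(q-1)\rceil}F^e_{H^i_{\mathfrak{m}}(R)}(z)=0$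 for all large $q=p^e$. Then $c_i(\mathfrak{m})=\sup\{t\in\mathbb{R}_{\geqslant 0}\mid 0^{F\sharp\mathfrak{m}^t}_{H^i_{\mathfrak{m}}(R)}=0\}$; so $c_i(\mathfrak{m})=\infty$ when $H^i_{\mathfrak{m}}(R)=0$. Let $\mathfrak{a}$ be an ideal containing an element not in any minimal prime, and $t\geqslant 0$ real. If $R$ is local, $(R,\mathfrak{a}^t)$ is weakly $F$-pure if there are infinitely many $e\in\mathbb{N}$ with elements $c_e\in\mathfrak{a}^{\lfloor t(p^e-1)\rfloor}$ such that the $R$-linear map $R\to F^e_*R$, $1\mapsto F^e_*c_e$, splits; in general, $(R,\mathfrak{a}^t)$ is weakly $F$-pure if $(R_{\mathfrak{n}},\mathfrak{a}_{\mathfrak{n}}^t)$ is so for every maximal ideal $\mathfrak{n}$. For $R$ $F$-pure, $\mathrm{fpt}(\mathfrak{a})=\sup\{t\in\mathbb{R}_{\geqslant 0}\mid (R,\mathfrak{a}^t)\text{ is weakly }F\text{-pure}\}$. *)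

(* Defs.v *)
From HB Require Import structures.
From mathcomp Require Import all_boot all_order all_algebra.
From mathcomp Require Import all_classical all_reals ereal.
From mathcomp Require Import ring.

Set Implicit Arguments.
Unset Strict Implicit.
Unset Printing Implicit Defensive.

Import Order.TTheory GRing.Theory Num.Theory.

Local Open Scope classical_set_scope.
Local Open Scope quotient_scope.
Local Open Scope ring_scope.

Section Ideals.
Variable A : comPzRingType.
Implicit Types I J : set A.

Definition is_ideal I :=
  [/\ I 0, forall a b, I a -> I b -> I (a + b) & forall a b, I b -> I (a * b)].

Definition ideal_gen (X : set A) : set A :=
  [set a | exists n (r y : 'I_n -> A),
     (forall i, X (y i)) /\ a = \sum_(i < n) r i * y i].

(* For N = 0 the empty product gives the unit ideal. *)
Definition ideal_pow I (N : nat) : set A :=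
  ideal_gen [set a | exists y : 'I_N -> A,
     (forall i, I (y i)) /\ a = \prod_(i < N) y i].

Definition is_maximal I :=
  [/\ is_ideal I, ~ I 1
    & forall J, is_ideal J -> ~ J 1 -> I `<=` J -> J `<=` I].

Definition noetherian :=
  forall I, is_ideal I -> exists n (y : 'I_n -> A), I = ideal_gen (range y).

Definition is_reduced := forall (a : A) k, a ^+ k = 0 -> a = 0.

End Ideals.

(* [loc S] is the localization of A at the multiplicative submonoid generated
   by an arbitrary subset S; it is the zero ring as soon as this submonoid
   contains 0. *)
Section Localization.
Variables (A : comPzRingType) (S : set A).

Definition submon : set A :=
  [set a | exists s : seq A, (forall y, y \in s -> S y) /\ a = \prod_(y <- s) y].

Lemma submon1 : submon 1.
Proof. by exists [::]; split; rewrite ?big_nil. Qed.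

Lemma submonM a b : submon a -> submon b -> submon (a * b).
Proof.
move=> [s [Ss ->]] [t [St ->]]; exists (s ++ t); split; last by rewrite big_cat.
by move=> y; rewrite mem_cat => /orP[/Ss|/St].
Qed.

Definition denom := {s : A | `[< submon s >]}.
Definition frac := (A * denom)%type.

Definition mkdenom s (Ss : submon s) : denom := exist _ s (asboolT Ss).
Definition denom1 := mkdenom submon1.

Lemma denomP (s : denom) : submon (sval s).
Proof. exact/asboolP/(valP s). Qed.

Definition denomM (s t : denom) := mkdenom (submonM (denomP s) (denomP t)).

Definition fraceq (u v : frac) : bool :=
  `[< exists w, submon w /\ w * (u.1 * sval v.2) = w * (v.1 * sval u.2) >].

Lemma fraceq_refl : reflexive fraceq.
Proof. by move=> u; apply/asboolP; exists 1; split => //; exact: submon1. Qed.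

Lemma fraceq_sym : symmetric fraceq.
Proof.
by move=> u v; apply/asboolP/asboolP => -[w [Sw e]]; exists w.
Qed.

Lemma fraceq_trans : transitive fraceq.
Proof.
move=> v u w /asboolP[a [Sa ea]] /asboolP[b [Sb eb]]; apply/asboolP.
exists (a * b * sval v.2); split.
  by apply: submonM; [exact: submonM|exact: denomP].
transitivity (a * (u.1 * sval v.2) * (b * sval w.2)); first by ring.
rewrite ea; transitivity (b * (v.1 * sval w.2) * (a * sval u.2)); first by ring.
by rewrite eb; ring.
Qed.

Canonical fraceq_equiv := EquivRel fraceq fraceq_refl fraceq_sym fraceq_trans.

Definition loc := {eq_quot fraceq}.

HB.instance Definition _ : EqQuotient _ fraceq loc := EqQuotient.on loc.
HB.instance Definition _ := Choice.on loc.

Definition fracD (u v : frac) : frac :=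
  (u.1 * sval v.2 + v.1 * sval u.2, denomM u.2 v.2).
Definition fracN (u : frac) : frac := (- u.1, u.2).
Definition fracM (u v : frac) : frac := (u.1 * v.1, denomM u.2 v.2).

Definition locD := lift_op2 loc fracD.
Definition locN := lift_op1 loc fracN.
Definition locM := lift_op2 loc fracM.
Definition loc0 : loc := \pi_loc (0, denom1).
Definition loc1 : loc := \pi_loc (1, denom1).

Lemma fraceqP (u v : frac) :
  (exists w, submon w /\ w * (u.1 * sval v.2) = w * (v.1 * sval u.2)) ->
  \pi_loc u = \pi_loc v.
Proof. by move=> h; apply/eqmodP/asboolP. Qed.

Lemma fraceq_repr (u : frac) :
  exists w, submon w /\
    w * (u.1 * sval (repr (\pi_loc u)).2) = w * ((repr (\pi_loc u)).1 * sval u.2).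
Proof. by apply/asboolP; have /eqmodP := esym (reprK (\pi_loc u)). Qed.

Lemma pi_locD : {morph \pi : x y / fracD x y >-> locD x y}.
Proof.
move=> x y; unlock locD; apply: fraceqP.
have [a [Sa ea]] := fraceq_repr x; have [b [Sb eb]] := fraceq_repr y.
exists (a * b); split; first exact: submonM.
move: ea eb; rewrite /fracD /=.
move: (repr (\pi_loc x)) (repr (\pi_loc y)) => x' y' ea eb.
transitivity (a * (x.1 * sval x'.2) * (b * sval y.2 * sval y'.2)
              + b * (y.1 * sval y'.2) * (a * sval x.2 * sval x'.2)); first by ring.
by rewrite ea eb; ring.
Qed.
Canonical pi_locD_morph := PiMorph2 pi_locD.

Lemma pi_locN : {morph \pi : x / fracN x >-> locN x}.
Proof.
move=> x; unlock locN; apply: fraceqP.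
have [a [Sa ea]] := fraceq_repr x; exists a; split => //.
by move: ea; rewrite /fracN /= !mulNr !mulrN => ->.
Qed.
Canonical pi_locN_morph := PiMorph1 pi_locN.

Lemma pi_locM : {morph \pi : x y / fracM x y >-> locM x y}.
Proof.
move=> x y; unlock locM; apply: fraceqP.
have [a [Sa ea]] := fraceq_repr x; have [b [Sb eb]] := fraceq_repr y.
exists (a * b); split; first exact: submonM.
move: ea eb; rewrite /fracM /=.
move: (repr (\pi_loc x)) (repr (\pi_loc y)) => x' y' ea eb.
transitivity (a * (x.1 * sval x'.2) * (b * (y.1 * sval y'.2))); first by ring.
by rewrite ea eb; ring.
Qed.
Canonical pi_locM_morph := PiMorph2 pi_locM.

Lemma fraceq1P (u v : frac) : u.1 * sval v.2 = v.1 * sval u.2 ->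
  \pi_loc u = \pi_loc v.
Proof.
by move=> e; apply: fraceqP; exists 1; split; [exact: submon1|rewrite e].
Qed.

Lemma locDA : associative locD.
Proof.
elim/quotW=> x; elim/quotW=> y; elim/quotW=> z; rewrite !piE.
by apply: fraceq1P => /=; ring.
Qed.

Lemma locDC : commutative locD.
Proof.
by elim/quotW=> x; elim/quotW=> y; rewrite !piE; apply: fraceq1P => /=; ring.
Qed.

Lemma loc0D : left_id loc0 locD.
Proof.
by elim/quotW=> x; rewrite /loc0 !piE; apply: fraceq1P => /=; ring.
Qed.

Lemma locND : left_inverse loc0 locN locD.
Proof.
by elim/quotW=> x; rewrite /loc0 !piE; apply: fraceq1P => /=; ring.
Qed.

HB.instance Definition _ := GRing.isZmodule.Build loc locDA locDC loc0D locND.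

Lemma locMA : associative locM.
Proof.
elim/quotW=> x; elim/quotW=> y; elim/quotW=> z; rewrite !piE.
by apply: fraceq1P => /=; ring.
Qed.

Lemma locMC : commutative locM.
Proof.
by elim/quotW=> x; elim/quotW=> y; rewrite !piE; apply: fraceq1P => /=; ring.
Qed.

Lemma loc1M : left_id loc1 locM.
Proof.
by elim/quotW=> x; rewrite /loc1 !piE; apply: fraceq1P => /=; ring.
Qed.

Lemma locMDl : left_distributive locM locD.
Proof.
elim/quotW=> x; elim/quotW=> y; elim/quotW=> z; rewrite !piE.
by apply: fraceq1P => /=; ring.
Qed.

HB.instance Definition _ :=
  GRing.Zmodule_isComPzRing.Build loc locMA locMC loc1M locMDl.

(* The fraction a/s; the value is 0 when s is not an admissible denominator. *)
Definition locfrac (a s : A) : loc :=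
  if pselect (submon s) is left Ss then \pi_loc (a, mkdenom Ss) else 0.

End Localization.

(* The map a/s |-> a/s; it is the canonical ring homomorphism whenever the
   submonoid generated by S is contained in the one generated by T, which is
   the only case used below. *)
Definition loc_map (A : comPzRingType) (S T : set A) (u : loc S) : loc T :=
  locfrac T (repr u).1 (sval (repr u).2).

Definition loc_ideal (A : comPzRingType) (S I : set A) : set (loc S) :=
  ideal_gen [set locfrac S a 1 | a in I].
Arguments loc_ideal : clear implicits.

(* Local cohomology H^i_I(A), for I generated by x_0, ..., x_{n-1}, is the
   cohomology of the Čech complex C^i = \prod_(#|T| = i) A[1/x_j : j in T];
   cohomology classes are handled through cocycles modulo coboundaries. The
   index i is an integer, so that C^i = 0 for i < 0. *)
Section Cech.
Variables (A : comPzRingType) (n : nat) (x : 'I_n -> A).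

Definition dens (T : {set 'I_n}) : set A := [set x j | j in [set` T]].

Definition cochain := forall T : {set 'I_n}, loc (dens T).

Definition in_degree (i : int) (c : cochain) :=
  forall T : {set 'I_n}, #|T|%:Z != i -> c T = 0.

Definition cech_d (c : cochain) : cochain := fun T =>
  \sum_(j in T)
    (-1) ^+ #|[set k in T | (k < j)%N]| * loc_map (dens T) (c (T :\ j)%SET).

Definition cocycle (i : int) (c : cochain) :=
  in_degree i c /\ (forall T, cech_d c T = 0).

Definition coboundary (i : int) (c : cochain) :=
  exists b, in_degree (i - 1) b /\ (forall T, c T = cech_d b T).

Definition cochain_scale (a : A) (c : cochain) : cochain :=
  fun T => locfrac (dens T) a 1 * c T.

(* In characteristic p the e-th Frobenius of each A[1/x_j : j in T] commutes
   with the differential; this is the induced action on cochains. *)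
Definition cochain_frob (p e : nat) (c : cochain) : cochain :=
  fun T => c T ^+ (p ^ e).

Definition frobenius_injective (p : nat) (i : int) :=
  forall z, cocycle i z -> coboundary i (cochain_frob p 1 z) -> coboundary i z.

End Cech.

Section Frobenius.
Variables (p : nat) (A : comPzRingType).

Definition F_finite :=
  exists n (g : 'I_n -> A), forall a, exists r : 'I_n -> A,
    a = \sum_(i < n) r i ^+ p * g i.

(* The A-linear map A -> F^e_* A, 1 |-> F^e_* c, has an A-linear retraction. *)
Definition frobenius_splits (e : nat) (c : A) :=
  exists phi : {additive A -> A},
    (forall r y, phi (r ^+ (p ^ e) * y) = r * phi y) /\ phi c = 1.

Definition F_pure := [/\ F_finite, is_reduced A & frobenius_splits 1 1].

End Frobenius.

(* [I] is the maximal ideal of the local ring A; local cohomology does not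
   depend on the system of generators y used to compute it. *)
Definition F_injective_local (p : nat) (A : comPzRingType) (I : set A) :=
  exists n (y : 'I_n -> A),
    I = ideal_gen (range y) /\ forall i : int, frobenius_injective y p i.

Definition F_injective (p : nat) (A : comPzRingType) :=
  [/\ F_finite p A, is_reduced A
    & forall I : set A, is_maximal I ->
        F_injective_local p (loc_ideal A (~` I) I)].

Section FPureThreshold.
Variables (K : realType) (p : nat).

(* Only used for t >= 0, where the absolute value merely casts int to nat. *)
Definition floor_exp (t : K) (e : nat) : nat :=
  `|Num.floor (t * (p ^ e - 1)%N%:R)|%N.
Definition ceil_exp (t : K) (e : nat) : nat :=
  `|Num.ceil (t * (p ^ e - 1)%N%:R)|%N.

Definition weakly_F_pure_local (A : comPzRingType) (I : set A) (t : K) :=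
  forall e0 : nat, exists2 e, (e0 <= e)%N &
    exists2 c, ideal_pow I (floor_exp t e) c & frobenius_splits p e c.

Definition weakly_F_pure (A : comPzRingType) (I : set A) (t : K) :=
  forall N : set A, is_maximal N ->
    weakly_F_pure_local (loc_ideal A (~` N) I) t.

Definition fpt (A : comPzRingType) (I : set A) : \bar K :=
  ereal_sup [set t%:E | t in [set t : K | 0 <= t /\ weakly_F_pure I t]].

(* The cocycle z represents an element of 0^{F # I^t}. *)
Definition F_sharp (A : comPzRingType) (n : nat) (x : 'I_n -> A) (I : set A)
    (t : K) (i : int) (z : cochain x) :=
  exists e0 : nat, forall e, (e0 <= e)%N ->
    forall r, ideal_pow I (ceil_exp t e) r ->
      coboundary i (cochain_scale r (cochain_frob p e z)).

(* [c_inv x i] is c_i(I) for the ideal I generated by x. *)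
Definition c_inv (A : comPzRingType) (n : nat) (x : 'I_n -> A) (i : int) :
    \bar K :=
  ereal_sup [set t%:E | t in [set t : K | 0 <= t /\
    forall z : cochain x, cocycle i z ->
      F_sharp (ideal_gen (range x)) t i z -> coboundary i z]].

End FPureThreshold.

Section Graded.
Variables (A : comPzRingType) (gr : nat -> set A).

Definition is_grading :=
  [/\ forall d, gr d 0 /\ (forall a b, gr d a -> gr d b -> gr d (a - b)),
      gr 0 1 /\ (forall d e a b, gr d a -> gr e b -> gr (d + e) (a * b)),
      forall a, exists n (f : nat -> A),
        (forall d, gr d (f d)) /\ a = \sum_(d < n) f d
    & forall n (f : nat -> A), (forall d, gr d (f d)) ->
        \sum_(d < n) f d = 0 -> forall d, (d < n)%N -> f d = 0].

Definition irrelevant_ideal : set A :=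
  ideal_gen [set a | exists d, (0 < d)%N /\ gr d a].

Definition grz (d : int) : set A :=
  if d is Posz m then gr m else [set 0].

Definition loc_homogeneous (S : set A) (d : int) (u : loc S) :=
  exists (k : nat) (a s : A),
    [/\ submon S s, gr k s, grz (d + k%:Z) a & u = locfrac S a s].

(* For homogeneous x, this says [H^i]_d != 0. *)
Definition cohomology_nonzero (n : nat) (x : 'I_n -> A) (i d : int) :=
  exists c : cochain x,
    [/\ cocycle i c, forall T, loc_homogeneous d (c T) & ~ coboundary i c].

(* a_i(A): over a nonempty set of integers bounded above the supremum is a
   maximum, and it is -oo when the cohomology vanishes. *)
Definition a_inv (K : realType) (n : nat) (x : 'I_n -> A) (i : int) : \bar K :=
  ereal_sup [set (d%:~R)%:E | d in [set d : int | cohomology_nonzero x i d]].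

End Graded.

(* Main.v *)
Require Import Defs.
From HB Require Import structures.
From mathcomp Require Import all_boot all_order all_algebra.
From mathcomp Require Import all_classical all_reals ereal.
From mathcomp Require Import ring lra zify.

(** Let [z] be a nonzero class of degree [d] in [H^i], let [t > - d] and
    [q = p ^ e]. The class [F^e z] has degree [q d], and an element of the
    [N]-th power of the irrelevant ideal, with [N] about [t (q - 1)], raises
    degrees by at least [N]. So its product with [F^e z] has components only in
    degrees at least about [t (q - 1) + q d = (t + d) (q - 1) + d], which tends to
    infinity with [q] ([degree_growth]). As [H^i] vanishes in high degree
    ([serre_vanishing]), the product is zero for large [q]
    ([exact_mul_Frobenius]).

    This gives both bounds. For [c_i], it puts the nonzero class [z] into the
    submodule attached to [t], so [t] is not admissible. For the F-pure threshold,
    an element [c] of order about [t (q - 1)] whose map [1 |-> F^e_* c] splits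
    over the localization at the irrelevant ideal would make [z |-> c F^e z]
    injective there ([exact_of_splitting]); and a homogeneous class that dies in
    that localization is already zero, because an element outside the irrelevant
    ideal has an invertible component of degree 0 ([exact_of_unit]).

    Čech cohomology is handled as the limit over [l] of the cohomology of the
    Koszul complexes of the powers [x j ^+ l]: a cochain is a family of elements of
    [R] indexed by sets of variables, and being a coboundary is a finite system
    of equations in [R] ([stably_exact]). Degree components can be taken in such
    equations, and a splitting of Frobenius can be applied to them.

    Serre vanishing is proved for the subquotients [I / J] of [R] by homogeneous
    ideals, by induction on the number of variables [x j] that do not act as zero.
    The kernel and the cokernel of multiplication by [x j] on [I / J] are
    subquotients on which one more variable acts as zero, so their cohomology
    vanishes in high degree and multiplication by [x j] is injective on the
    cohomology of [I / J] there ([exact_of_mul]). But each class is killed by a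
    power of [x j], hence it is zero ([vanishes_of_mul]). *)

Set Implicit Arguments.
Unset Strict Implicit.
Unset Printing Implicit Defensive.

Import Order.TTheory GRing.Theory Num.Theory.

Local Open Scope classical_set_scope.
Local Open Scope ring_scope.

(** * Ideals *)

Section Ideal.
Variable A : comPzRingType.
Implicit Types (I : set A) (X : set A).

Lemma idealN I a : is_ideal I -> I a -> I (- a).
Proof. by case=> _ _ IM Ia; rewrite -mulN1r; exact: IM. Qed.

Lemma idealB I a b : is_ideal I -> I a -> I b -> I (a - b).
Proof. by move=> Iid Ia Ib; case: (Iid) => _ ID _; apply: ID => //; exact: idealN. Qed.

Lemma ideal_sum I (T : finType) (P : pred T) (F : T -> A) :
  is_ideal I -> (forall i, P i -> I (F i)) -> I (\sum_(i | P i) F i).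
Proof. by move=> [I0 ID _] IF; apply: big_ind. Qed.

Lemma sub_ideal_gen X : X `<=` ideal_gen X.
Proof.
move=> a Xa; exists 1, (fun=> 1), (fun=> a); split=> //.
by rewrite big_ord1 mul1r.
Qed.

Lemma ideal_gen_min X I : is_ideal I -> X `<=` I -> ideal_gen X `<=` I.
Proof.
move=> Iid XI _ [m [r [y [Xy ->]]]]; apply: ideal_sum => // i _.
by case: Iid => _ _; apply; exact: XI.
Qed.

Lemma ideal_zero : is_ideal ([set 0] : set A).
Proof. by split=> // [a b -> ->|a b ->]; rewrite /= ?addr0 ?mulr0. Qed.

Lemma ideal_full : is_ideal (setT : set A).
Proof. by split. Qed.

End Ideal.

(** * Homogeneous components of a graded ring *)

Lemma sum_widen (V : zmodType) (f : nat -> V) n N : (n <= N)%N ->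
  (forall d, (n <= d)%N -> f d = 0) -> \sum_(i < n) f i = \sum_(i < N) f i.
Proof.
move=> nN f0; rewrite (big_ord_widen _ _ nN).
rewrite [RHS](bigID (fun i : 'I_N => (i < n)%N)) /= [X in _ + X]big1 ?addr0 //.
by move=> i; rewrite -leqNgt => /f0.
Qed.

Section GradedRing.
Variables (R : comNzRingType) (gr : nat -> set R).
Hypothesis grP : is_grading gr.

Let gr0 d : gr d 0. Proof. by case: grP => /(_ d)[]. Qed.
Let grB d a b : gr d a -> gr d b -> gr d (a - b).
Proof. by case: grP => /(_ d)[_ h] _ _ _; exact: h. Qed.
Let grM d e a b : gr d a -> gr e b -> gr (d + e) (a * b).
Proof. by case: grP => _ [_ h] _ _; exact: h. Qed.

Definition decomposes (f : nat -> R) (a : R) := (forall d, gr d (f d)) /\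
  exists2 n, forall d, (n <= d)%N -> f d = 0 & a = \sum_(d < n) f d.

Lemma decomposition a : exists f, decomposes f a.
Proof.
case: grP => _ _ /(_ a)[n [f [grf ->]]] _.
exists (fun d => if (d < n)%N then f d else 0); split.
  by move=> d; case: ifP.
exists n => [d|]; first by rewrite leqNgt => /negbTE ->.
by apply: eq_bigr => i _; rewrite ltn_ord.
Qed.

Lemma decomposition_unique f g a :
  decomposes f a -> decomposes g a -> f =1 g.
Proof.
move=> [grf [n f0 ->]] [grg [m g0 e]] d.
pose N := maxn (maxn n m) d.+1.
case: grP => _ _ _ /(_ N (fun i => f i - g i)) h.
apply/eqP; rewrite -subr_eq0; apply/eqP/h => [i||]; rewrite /N; try lia.
  exact: grB.
move: e; rewrite sumrB (@sum_widen _ f n N) ?(@sum_widen _ g m N) //;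
  rewrite /N; try lia.
by move=> ->; rewrite subrr.
Qed.

(** Homogeneous components are indexed by integers, with value 0 in negative
    degrees, because cohomology classes may have negative degree. *)
Definition hcomp (d : int) (a : R) : R :=
  if d is Posz m then sval (cid (decomposition a)) m else 0.
Arguments hcomp : simpl never.

Lemma hcomp_decomposes a : decomposes (fun m => hcomp m%:Z a) a.
Proof. by rewrite /hcomp; case: cid. Qed.

Lemma hcompE f a d : decomposes f a -> hcomp d%:Z a = f d.
Proof. by move/(decomposition_unique (hcomp_decomposes a)) ->. Qed.

Lemma hcomp_is_additive d : zmod_morphism (hcomp d).
Proof.
case: d => [m|m] a b; last by rewrite /hcomp subrr.
have [gra [n a0 ea]] := hcomp_decomposes a.
have [grb [k b0 eb]] := hcomp_decomposes b.
apply: (@hcompE (fun m => hcomp m%:Z a - hcomp m%:Z b)); split=> [j|].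
  exact: grB.
exists (n + k)%N => [j nj|]; first by rewrite a0 ?b0 ?subrr //; lia.
rewrite {1}ea {1}eb sumrB.
by congr (_ - _); apply: (@sum_widen _ (fun j => hcomp j%:Z _)) => //; lia.
Qed.

HB.instance Definition _ d :=
  GRing.isZmodMorphism.Build R R (hcomp d) (hcomp_is_additive d).

Lemma grz_hcomp d a : grz gr d (hcomp d a).
Proof. by case: d => [m|m] //; case: (hcomp_decomposes a) => gra _; exact: gra. Qed.

Lemma hcomp_sum a : exists n, a = \sum_(d < n) hcomp d%:Z a.
Proof. by have [_ [n _ ea]] := hcomp_decomposes a; exists n. Qed.

Lemma hcomp_grz d e a : grz gr e a -> hcomp d a = if d == e then a else 0.
Proof.
case: e => [m|m] /=; last by move=> ->; rewrite raddf0 if_same.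
case: d => [k|k] //= gra.
apply: (@hcompE (fun k => if Posz k == m then a else 0)); split=> [j|].
  by case: eqP => // -[->].
exists m.+1 => [j mj|]; first by case: eqP => // -[ej]; lia.
rewrite (bigD1 ord_max) //= eqxx big1 ?addr0 // => i /eqP im.
by case: eqP => // -[ei]; case: im; apply: val_inj.
Qed.

Lemma hcomp_id d a : grz gr d a -> hcomp d a = a.
Proof. by move/hcomp_grz ->; rewrite eqxx. Qed.

Lemma grz0 d : grz gr d 0.
Proof. by case: d => /=. Qed.

Lemma grzB d a b : grz gr d a -> grz gr d b -> grz gr d (a - b).
Proof. by case: d => [m|m] /=; [exact: grB|move=> -> ->; rewrite subrr]. Qed.

Lemma grzN d a : grz gr d a -> grz gr d (- a).
Proof. by move=> ga; rewrite -[- a]add0r; apply: grzB => //; exact: grz0. Qed.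

Lemma grzM d e a b : grz gr d a -> grz gr e b -> grz gr (d + e) (a * b).
Proof.
case: d => [m|m] /=; last by move=> -> _; rewrite mul0r; exact: grz0.
case: e => [k|k] /=; last by move=> _ ->; rewrite mulr0; exact: grz0.
exact: grM.
Qed.

Lemma grz1 : grz gr 0 1.
Proof. by case: grP => _ []. Qed.

Lemma grzX d a q : grz gr d a -> grz gr (d *+ q) (a ^+ q).
Proof.
move=> ga; elim: q => [|q IH]; first exact: grz1.
by rewrite exprS mulrS; exact: grzM.
Qed.

Lemma grX d a q : gr d a -> gr (q * d)%N (a ^+ q).
Proof.
move=> ga; have := grzX q (ga : grz gr d a).
by rewrite -mulr_natl natz -PoszM.
Qed.

Lemma grz_prod (T : finType) (P : pred T) (d : T -> int) (f : T -> R) :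
  (forall i, grz gr (d i) (f i)) ->
  grz gr (\sum_(i | P i) d i) (\prod_(i | P i) f i).
Proof.
move=> h; apply: (big_ind2 (fun d a => grz gr d a)) => //; first exact: grz1.
by move=> *; exact: grzM.
Qed.

Lemma hcompM d e a b : gr e a -> hcomp d (a * b) = a * hcomp (d - e%:Z) b.
Proof.
move=> ga; have [n ->] := hcomp_sum b.
rewrite mulr_sumr !raddf_sum mulr_sumr /=; apply: eq_bigr => i _.
rewrite (@hcomp_grz d (e%:Z + i%:Z)); last first.
  by apply: grzM; [exact: ga|exact: grz_hcomp].
rewrite (@hcomp_grz (d - e%:Z) i); last exact: grz_hcomp.
by rewrite subr_eq addrC; case: eqP => _; rewrite ?mulr0.
Qed.

Lemma hcompMz d e a b : grz gr e a -> hcomp d (a * b) = a * hcomp (d - e) b.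
Proof.
by case: e => [m|m]; [exact: hcompM|move=> ->; rewrite !mul0r raddf0].
Qed.

Lemma hcomp0M a b : hcomp 0 (a * b) = hcomp 0 a * hcomp 0 b.
Proof.
have [_ [n _ ea]] := hcomp_decomposes a; rewrite {1}ea mulr_suml raddf_sum.
case: n ea => [|n] ea.
  by rewrite ea !big_ord0 raddf0 mul0r.
rewrite big_ord_recl big1 ?addr0 /=.
  by rewrite (@hcompM 0 0%N) ?subr0 //; exact: (grz_hcomp 0).
move=> i _; rewrite (@hcompM 0 (bump 0 i)) ?mulr0 //.
exact: (grz_hcomp (bump 0 i)).
Qed.

Definition homogeneous_ideal (I : set R) :=
  is_ideal I /\ forall d a, I a -> I (hcomp d a).

(** The elements of order at least [N] for the grading: they contain the
    [N]-th power of the irrelevant ideal, which is all that degree arguments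
    remember of it. *)
Definition order_ge (N : nat) : set R :=
  [set a | forall d, (d < N)%N -> hcomp d%:Z a = 0].

Lemma hcomp_order_ge N d a : order_ge N a -> d < N%:Z -> hcomp d a = 0.
Proof. by case: d => [m|m] //= aN mN; exact: aN. Qed.

Lemma order_geM N M a b :
  order_ge N a -> order_ge M b -> order_ge (N + M) (a * b).
Proof.
move=> aN bM d dNM; have [n ea] := hcomp_sum a.
rewrite ea mulr_suml raddf_sum big1 //= => i _.
rewrite (@hcompM _ i); last exact: (grz_hcomp i).
have [/aN ->|Ni] := ltnP i N; first by rewrite mul0r.
by rewrite (hcomp_order_ge bM) ?mulr0 //; lia.
Qed.

Lemma order_ge_ideal N : is_ideal (order_ge N).
Proof.
split=> [d _|a b aN bN d dN|a b bN].
- exact: raddf0.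
- by rewrite raddfD /= aN ?bN ?addr0.
- by apply: (@order_geM 0).
Qed.

Lemma irrelevant_idealE : irrelevant_ideal gr = order_ge 1.
Proof.
apply/seteqP; split.
  apply: ideal_gen_min; first exact: order_ge_ideal.
  move=> a [d [d0 ga]] [|//] _; rewrite (@hcomp_grz _ d) //.
  by case: eqP d0 => // -[<-].
move=> a a1; have [n ea] := hcomp_sum a.
exists n, (fun=> 1), (fun i : 'I_n => hcomp i%:Z a).
split; last by rewrite {1}ea; apply: eq_bigr => i _; rewrite mul1r.
(* The generator of index 0 is the component of degree 0, which vanishes; it is
   placed in degree 1. *)
move=> [[|i] lti] /=; last by exists i.+1; split=> //; exact: (grz_hcomp i.+1).
by exists 1; rewrite a1.
Qed.

Lemma irrelevant_pow N : ideal_pow (irrelevant_ideal gr) N `<=` order_ge N.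
Proof.
rewrite irrelevant_idealE; apply: ideal_gen_min; first exact: order_ge_ideal.
move=> _ [y [Iy ->]]; elim: N y Iy => [|N IH] y Iy; first by [].
by rewrite big_ord_recl; apply: (@order_geM 1 N) => //; apply: IH => i; exact: Iy.
Qed.

End GradedRing.

Arguments hcomp : simpl never.

(** * Koszul complexes and their limit *)

Section Koszul.
Variables (R : comNzRingType) (n : nat) (x : 'I_n -> R).
Local Notation cochains := ({set 'I_n} -> R).
Implicit Types (T : {set 'I_n}) (l s : nat) (f g : cochains) (I J : set R).

Definition sgn T (j : 'I_n) : R := (-1) ^+ #|[set k in T | (k < j)%N]|%SET.

Definition mon T : R := \prod_(j in T) x j.

Definition koszul_d l f : cochains :=
  fun T => \sum_(j in T) sgn T j * (x j ^+ l * f (T :\ j)%SET).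

Lemma sgnK T j a : sgn T j * (sgn T j * a) = a.
Proof. by rewrite /sgn signrMK. Qed.

Lemma sgn_swap T (i j : 'I_n) : i \in T -> (i < j)%N ->
  sgn T j * sgn (T :\ j)%SET i = - (sgn T i * sgn (T :\ i)%SET j).
Proof.
move=> iT ij; rewrite /sgn.
have -> : [set k in (T :\ j)%SET | (k < i)%N]%SET = [set k in T | (k < i)%N]%SET.
  apply/setP=> k; rewrite !inE; case: eqP => //= ->.
  by rewrite ltnNge (ltnW ij) andbF.
rewrite [#|[set k in T | (k < j)%N]%SET|](cardsD1 i) inE iT ij /=.
have -> : ([set k in T | (k < j)%N] :\ i)%SET = [set k in (T :\ i)%SET | (k < j)%N]%SET.
  by apply/setP=> k; rewrite !inE andbA.
by rewrite exprS mulN1r mulNr mulrC.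
Qed.

Lemma koszul_dD l f g T :
  koszul_d l (fun T => f T + g T) T = koszul_d l f T + koszul_d l g T.
Proof. by rewrite /koszul_d -big_split /=; apply: eq_bigr => j _; ring. Qed.

Lemma koszul_dB l f g T :
  koszul_d l (fun T => f T - g T) T = koszul_d l f T - koszul_d l g T.
Proof.
by rewrite /koszul_d -sumrB; apply: eq_bigr => j _; ring.
Qed.

Lemma koszul_dZ l a f T :
  koszul_d l (fun T => a * f T) T = a * koszul_d l f T.
Proof. by rewrite /koszul_d mulr_sumr; apply: eq_bigr => j _; ring. Qed.

Lemma koszul_d_ideal l I f T :
  is_ideal I -> (forall T, I (f T)) -> I (koszul_d l f T).
Proof.
move=> Iid If; apply: ideal_sum => // j _.
by case: Iid => _ _ IM; apply/IM/IM.
Qed.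

Lemma monD1 T j : j \in T -> mon T = x j * mon (T :\ j)%SET.
Proof. by move=> jT; rewrite /mon (big_setD1 j). Qed.

(** Multiplication by [mon T ^+ s] is the transition map from level [l] to level
    [l + s] in the system of Koszul complexes of the [x j ^+ l]. *)
Lemma koszul_d_shift l s f T :
  koszul_d (l + s) (fun T => mon T ^+ s * f T) T = mon T ^+ s * koszul_d l f T.
Proof.
rewrite /koszul_d mulr_sumr; apply: eq_bigr => j jT.
by rewrite (monD1 jT) exprMn exprD; ring.
Qed.

(** The terms that remove [i] and [j] cancel in pairs, by [sgn_swap]; pairing
    [i < j] with [j < i] keeps the argument valid in characteristic 2. *)
Lemma koszul_d_d l f T : koszul_d l (koszul_d l f) T = 0.
Proof.
pose G i j := sgn T j * sgn (T :\ j)%SET i *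
  (x i ^+ l * x j ^+ l * f (T :\ j :\ i)%SET).
have -> : koszul_d l (koszul_d l f) T =
    \sum_(j in T) \sum_(i in T | i != j) G i j.
  apply: eq_bigr => j jT; rewrite mulr_sumr mulr_sumr.
  by apply: eq_big => [i|i _]; rewrite ?inE 1?andbC // /G; ring.
have -> : \sum_(j in T) \sum_(i in T | i != j) G i j =
    \sum_(j in T) \sum_(i in T | (i < j)%N) G i j +
    \sum_(j in T) \sum_(i in T | (j < i)%N) G i j.
  rewrite -big_split; apply: eq_bigr => j jT /=.
  rewrite (bigID (fun i : 'I_n => (i < j)%N)) /=.
  by congr (_ + _); apply: eq_bigl => i; rewrite -val_eqE /=; case: ltngtP;
    rewrite ?andbT ?andbF.
rewrite [X in _ + X](exchange_big_dep (fun i => i \in T)) /=; last first.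
  by move=> j i _ /andP[].
rewrite -big_split big1 //= => j jT.
rewrite jT -big_split big1 //= => i /andP[iT ij].
have TE : (T :\ i :\ j = T :\ j :\ i)%SET.
  by apply/setP => k; rewrite !inE andbCA.
by rewrite /G (sgn_swap iT ij) TE; ring.
Qed.

(** Multiplication by [x j ^+ l] is null-homotopic on the level [l] complex,
    through contraction with the variable [j]. This is why cohomology is
    torsion for the ideal generated by the [x j]. *)
Definition contract (j : 'I_n) f : cochains :=
  fun T => if j \in T then 0 else sgn (j |: T)%SET j * f (j |: T)%SET.

Lemma contractP j l f T :
  koszul_d l (contract j f) T + contract j (koszul_d l f) T = x j ^+ l * f T.
Proof.
have [jT|jT] := boolP (j \in T).
  rewrite [contract j _ T]/contract jT addr0 /koszul_d (bigD1 j) //=.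
  rewrite [X in _ + X]big1 ?addr0 => [|i /andP[iT ij]].
    by rewrite /contract setD11 finset.setD1K // mulrCA sgnK.
  by rewrite /contract in_setD1 jT eq_sym ij !mulr0.
rewrite {2}/contract (negbTE jT) /koszul_d [X in _ + _ * X](bigD1 j) ?setU11 //=.
rewrite finset.setU1K // mulrDr sgnK addrCA -[RHS]addr0; congr (_ + _).
rewrite mulr_sumr [X in _ + X](eq_bigl (mem T)); last first.
  move=> i; rewrite !inE; case: (i =P j) => [->|_]; last by rewrite andbT.
  by rewrite /= (negbTE jT).
rewrite -big_split big1 //= => i iT.
have ij : i != j by apply: contraNneq jT => <-.
pose U := (j |: T)%SET.
have [jU iU] : j \in U /\ i \in U by rewrite !inE eqxx iT orbT.
have swap : sgn U i * sgn (U :\ i)%SET j = - (sgn U j * sgn (U :\ j)%SET i).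
  have /orP[ji|ij'] : ((j < i)%N || (i < j)%N) by rewrite -neq_ltn eq_sym.
    exact: sgn_swap.
  by rewrite (sgn_swap iU ij') opprK.
have TiE : (j |: (T :\ i) = U :\ i)%SET.
  apply/setP => k; rewrite !inE; case: (k =P j) => [->|] //=.
  by rewrite eq_sym ij.
have TE : T = (U :\ j)%SET by rewrite finset.setU1K.
rewrite /contract in_setD1 (negbTE jT) andbF TiE -/U {1}TE.
set a := _ ^+ l; set b := f _.
have -> : sgn (U :\ j)%SET i * (a * (sgn (U :\ i)%SET j * b)) =
  sgn (U :\ j)%SET i * (sgn (U :\ i)%SET j * (sgn U i * (sgn U i * (a * b)))).
  by rewrite sgnK; ring.
transitivity ((sgn U i * sgn (U :\ i)%SET j) * (sgn U i * sgn (U :\ j)%SET i) *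
  (a * b) + sgn U j * (sgn U i * (a * b))); first by ring.
rewrite swap.
have -> : - (sgn U j * sgn (U :\ j)%SET i) * (sgn U i * sgn (U :\ j)%SET i) =
  - (sgn U j * (sgn (U :\ j)%SET i * (sgn (U :\ j)%SET i * sgn U i))) by ring.
by rewrite sgnK; ring.
Qed.

Lemma contract_ideal j I f T :
  is_ideal I -> (forall T, I (f T)) -> I (contract j f T).
Proof.
by move=> [I0 _ IM] If; rewrite /contract; case: ifP => // _; apply: IM.
Qed.

(** A cochain [f] at level [l] stands for the Čech cochain [f T / mon T ^+ l];
    it is a Čech coboundary exactly when it becomes a Koszul coboundary at a
    higher level, where fractions and annihilators of denominators have been
    cleared. The coefficients are the subquotient [I / J] of [R]. *)
Definition stably_exact I J l f := exists s g, (forall T, I (g T)) /\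
  forall T, J (mon T ^+ s * f T - koszul_d (l + s) g T).

Lemma exact_shift I J l s f :
  stably_exact I J (l + s) (fun T => mon T ^+ s * f T) -> stably_exact I J l f.
Proof.
move=> [s' [g [Ig Jg]]]; exists (s + s')%N, g; split=> // T.
by rewrite exprD addnA [_ ^+ s * _]mulrC -mulrA; apply: Jg.
Qed.

Lemma exact_raise I J l f N : is_ideal I -> is_ideal J -> stably_exact I J l f ->
  exists s g, [/\ (N <= s)%N, forall T, I (g T)
    & forall T, J (mon T ^+ s * f T - koszul_d (l + s) g T)].
Proof.
move=> [_ _ IM] [_ _ JM] [s [g [Ig Jg]]].
exists (s + N)%N, (fun T => mon T ^+ N * g T); split=> [|T|T].
- exact: leq_addl.
- exact: IM.
- rewrite addnA koszul_d_shift exprD.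
  suff -> : mon T ^+ s * mon T ^+ N * f T - mon T ^+ N * koszul_d (l + s) g T =
      mon T ^+ N * (mon T ^+ s * f T - koszul_d (l + s) g T) by exact: JM.
  by ring.
Qed.

Lemma exactD I J l f g : is_ideal I -> is_ideal J ->
  stably_exact I J l f -> stably_exact I J l g ->
  stably_exact I J l (fun T => f T + g T).
Proof.
move=> Iid Jid [s [f' [If Jf]]] eg.
have [t [g' [st Ig Jg]]] := exact_raise s Iid Jid eg.
case: (Iid) (Jid) => _ ID IM [_ JD JM].
exists t, (fun T => mon T ^+ (t - s) * f' T + g' T); split=> [T|T].
  by apply: ID => //; apply: IM.
rewrite koszul_dD.
have -> : koszul_d (l + t) (fun T => mon T ^+ (t - s) * f' T) T =
    mon T ^+ (t - s) * koszul_d (l + s) f' T.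
  by rewrite -koszul_d_shift -addnA subnKC.
have -> : mon T ^+ t * (f T + g T) -
    (mon T ^+ (t - s) * koszul_d (l + s) f' T + koszul_d (l + t) g' T) =
    mon T ^+ (t - s) * (mon T ^+ s * f T - koszul_d (l + s) f' T) +
    (mon T ^+ t * g T - koszul_d (l + t) g' T).
  have -> : mon T ^+ t = mon T ^+ (t - s) * mon T ^+ s by rewrite -exprD subnK.
  by ring.
by apply: JD => //; apply: JM.
Qed.

End Koszul.

(** * Vanishing of cohomology in high degree *)

Section Vanishing.
Variables (R : comNzRingType) (gr : nat -> set R).
Hypotheses (grP : is_grading gr) (R_noeth : noetherian R).
Variables (n : nat) (x : 'I_n -> R) (e : 'I_n -> nat).
Hypothesis x_homog : forall j, gr (e j) (x j).
Local Notation cochains := ({set 'I_n} -> R).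
Local Notation hcomp := (hcomp grP).
Local Notation kd := (koszul_d x).
Local Notation mon := (mon x).
Implicit Types (T : {set 'I_n}) (l s : nat) (d : int) (f g : cochains).
Implicit Types (I J : set R).

(** The degree of the [T]-component of a level [l] cochain that represents a
    class of degree [d]. *)
Definition wt d l T : int := d + (l * \sum_(j in T) e j)%N%:Z.

Definition cochain_hcomp d l f : cochains := fun T => hcomp (wt d l T) (f T).

Lemma gr_mon s T : gr (s * \sum_(j in T) e j)%N (mon T ^+ s).
Proof.
apply: (grX grP); have := grz_prod grP (mem T) (fun j => x_homog j : grz gr (e j) _).
by rewrite -(big_morph Posz PoszD erefl).
Qed.

Lemma hcomp_mon d l s T a :
  hcomp (wt d (l + s) T) (mon T ^+ s * a) = mon T ^+ s * hcomp (wt d l T) a.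
Proof.
rewrite (hcompM grP _ a (gr_mon s T)); congr (_ * hcomp _ _).
by rewrite /wt; lia.
Qed.

Lemma gr_sgn T j : gr 0%N (sgn R T j).
Proof.
have g1 := grz1 grP; rewrite /sgn -signr_odd.
by case: odd; [apply: (grzN grP g1)|].
Qed.

Lemma hcomp_koszul_d d l f T :
  hcomp (wt d l T) (kd l f T) = kd l (cochain_hcomp d l f) T.
Proof.
rewrite /koszul_d raddf_sum; apply: eq_bigr => j jT /=.
rewrite (hcompM grP _ _ (gr_sgn T j)) (@hcompM _ _ grP _ (l * e j)%N); last first.
  exact: grX.
congr (_ * (_ * hcomp _ _)); rewrite /wt (big_setD1 j jT) /=; lia.
Qed.

Lemma grz_mon d l s T a :
  grz gr (wt d l T) a -> grz gr (wt d (l + s) T) (mon T ^+ s * a).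
Proof.
have -> : wt d (l + s) T = (s * \sum_(j in T) e j)%N%:Z + wt d l T.
  by rewrite /wt; lia.
by apply: grzM => //; exact: gr_mon.
Qed.

Definition vanishes_from (D : int) I J := forall d l f, D <= d ->
  (forall T, I (f T)) -> (forall T, grz gr (wt d l T) (f T)) ->
  (forall T, J (kd l f T)) -> stably_exact x I J l f.

(** [I / quotient_by j I J] and [annihilated_by j I J / J] are the cokernel and
    the kernel of multiplication by [x j] on [I / J]. *)
Definition quotient_by (j : 'I_n) I J : set R :=
  [set a | exists b c, [/\ J b, I c & a = b + x j * c]].

Definition annihilated_by (j : 'I_n) I J : set R :=
  [set a | I a /\ J (x j * a)].

Lemma quotient_homog j I J : homogeneous_ideal grP I -> homogeneous_ideal grP J ->
  homogeneous_ideal grP (quotient_by j I J).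
Proof.
move=> [[I0 ID IM] Ih] [[J0 JD JM] Jh]; split; last first.
  move=> d _ [b [c [Jb Ic ->]]]; exists (hcomp d b), (hcomp (d - (e j)%:Z) c).
  by split; [exact: Jh|exact: Ih|rewrite raddfD /= (hcompM grP _ _ (x_homog j))].
split=> [|_ _ [b [c [Jb Ic ->]]] [b' [c' [Jb' Ic' ->]]]|a _ [b [c [Jb Ic ->]]]].
- by exists 0, 0; split=> //; ring.
- by exists (b + b'), (c + c'); split; [exact: JD|exact: ID|ring].
- by exists (a * b), (a * c); split; [exact: JM|exact: IM|ring].
Qed.

Lemma annihilated_homog j I J : homogeneous_ideal grP I -> homogeneous_ideal grP J ->
  homogeneous_ideal grP (annihilated_by j I J).
Proof.
move=> [[I0 ID IM] Ih] [[J0 JD JM] Jh]; split; last first.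
  move=> d a [Ia Ja]; split; first exact: Ih.
  by have := Jh (d + (e j)%:Z) _ Ja; rewrite (hcompM grP _ _ (x_homog j)) addrK.
split=> [|a b [Ia Ja] [Ib Jb]|a b [Ib Jb]].
- by split=> //; rewrite mulr0.
- by split; [exact: ID|rewrite mulrDr; exact: JD].
- by split; [exact: IM|rewrite mulrCA; exact: JM].
Qed.

(** Write [x] for [x j], [M] for [I / J] and [K] for [annihilated_by j I J]. In the
    long exact sequences of [0 -> K/J -> M -> x M -> 0] and
    [0 -> x M -> M -> M / x M -> 0] the cohomology of [K/J] and of [M / x M]
    vanishes in high degree; hence multiplication by [x] is injective on the
    cohomology of [M] there. The proof is the corresponding diagram chase. *)
Lemma exact_of_mul j I J D :
  homogeneous_ideal grP I -> homogeneous_ideal grP J -> J `<=` I ->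
  vanishes_from D (annihilated_by j I J) J ->
  vanishes_from D I (quotient_by j I J) ->
  forall d l f, D <= d ->
  (forall T, I (f T)) -> (forall T, grz gr (wt d l T) (f T)) ->
  (forall T, J (kd l f T)) ->
  stably_exact x I J l (fun T => x j * f T) -> stably_exact x I J l f.
Proof.
move=> Ihom Jhom JI vK vQ d l f Dd If gf Jf [s [b [Ib Jb]]].
have [[Iid Ih] [Jid Jh]] := (Ihom, Jhom).
have [[_ ID IM] [_ JD JM]] := (Iid, Jid).
pose g := cochain_hcomp (d + (e j)%:Z) (l + s) b.
have Ig T : I (g T) by exact: Ih.
have wtE l' T : wt (d + (e j)%:Z) l' T = (e j)%:Z + wt d l' T by rewrite /wt; lia.
have Jg T : J (mon T ^+ s * (x j * f T) - koszul_d x (l + s) g T).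
  have := Jh (wt (d + (e j)%:Z) (l + s) T) _ (Jb T).
  rewrite raddfB /= hcomp_koszul_d hcomp_mon hcomp_id //.
  by rewrite wtE; apply: (grzM grP (x_homog j : grz gr (e j) _)).
have [s2 [h [Ih2 Jh2]]] : stably_exact x I (quotient_by j I J) (l + s) g.
  apply: (vQ (d + (e j)%:Z)) => // [|T|T]; first by lia.
    exact: grz_hcomp.
  exists (- (mon T ^+ s * (x j * f T) - koszul_d x (l + s) g T)), (mon T ^+ s * f T).
  by split; [exact: idealN|exact: IM|ring].
(* The cochain [g] with [d g = x f] modulo [J] is a cocycle modulo [J + x I],
   hence a coboundary there: [g = d h + x a] modulo [J]. *)
have /choice[a ha] : forall T, exists a, I a /\
    J (mon T ^+ s2 * g T - koszul_d x (l + s + s2) h T - x j * a).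
  move=> T; have [b' [c [Jb' Ic ->]]] := Jh2 T; exists c; split=> //.
  by rewrite addrK.
pose L := (l + s + s2)%N.
pose fL T := mon T ^+ (s + s2) * f T.
have If' T : I (fL T) by apply: IM.
have gfL T : grz gr (wt d L T) (fL T) by rewrite /L -addnA; apply: grz_mon.
(* Since [d g = x d a] modulo [J], the cocycle [f - d a] has values in [K]. *)
have Jxa T : J (x j * (fL T - koszul_d x L a T)).
  have -> : x j * (fL T - koszul_d x L a T) =
     mon T ^+ s2 * (mon T ^+ s * (x j * f T) - koszul_d x (l + s) g T) +
     koszul_d x L (fun T => mon T ^+ s2 * g T - koszul_d x L h T - x j * a T) T.
    rewrite !koszul_dB koszul_dZ koszul_d_d koszul_d_shift /fL exprD; ring.
  apply: JD; first exact: JM.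
  by apply: koszul_d_ideal => // T'; case: (ha T').
(* [a] is replaced by its homogeneous part to stay in degree [d]. *)
pose a' := cochain_hcomp d L a.
have Ia' T : I (a' T) by apply: Ih; case: (ha T).
pose k T := fL T - koszul_d x L a' T.
have kE T : k T = hcomp (wt d L T) (fL T - koszul_d x L a T).
  by rewrite raddfB /= hcomp_koszul_d hcomp_id.
have Kk T : annihilated_by j I J (k T).
  split; first by apply: idealB => //; exact: koszul_d_ideal.
  have := Jh (wt (d + (e j)%:Z) L T) _ (Jxa T).
  by rewrite (hcompM grP _ _ (x_homog j)) wtE addrC addKr -kE.
have [s3 [t [Kt Jt]]] : stably_exact x (annihilated_by j I J) J L k.
  apply: (vK d) => // T; first by rewrite kE; exact: grz_hcomp.
  rewrite koszul_dB koszul_d_d subr0 /fL /L -addnA koszul_d_shift; exact: JM.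
apply: (@exact_shift _ _ _ I J l (s + s2)); rewrite addnA.
exists s3, (fun T => mon T ^+ s3 * a' T + t T); split=> T.
  by apply: ID; [exact: IM|case: (Kt T)].
rewrite koszul_dD koszul_d_shift.
have := Jt T; rewrite /k mulrBr opprD addrA; exact.
Qed.

(** Every class is killed by a power of [x j], because the Koszul complex at
    level [l] is contracted by [x j ^+ l]; injectivity of multiplication by
    [x j] in high degree therefore forces the class to vanish. *)
Lemma vanishes_of_mul j I J D :
  homogeneous_ideal grP I -> homogeneous_ideal grP J -> J `<=` I ->
  vanishes_from D (annihilated_by j I J) J ->
  vanishes_from D I (quotient_by j I J) -> vanishes_from D I J.
Proof.
move=> Ihom Jhom JI vK vQ d l f Dd If gf Jf.
have [[Iid _] [Jid _]] := (Ihom, Jhom).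
have [[_ _ IM] [_ _ JM]] := (Iid, Jid).
have xl : stably_exact x I J l (fun T => x j ^+ l * f T).
  exists 0%N, (contract j f); split=> T; first exact: contract_ideal.
  rewrite addn0 mul1r -(contractP x j l f T) addrC addKr.
  exact: contract_ideal.
suff desc k : stably_exact x I J l (fun T => x j ^+ k * f T) -> stably_exact x I J l f.
  exact: desc xl.
elim: k => [|k IH]; first by under [fun T => _ * _]eq_fun do rewrite mul1r.
move=> h; apply: IH; apply: (exact_of_mul Ihom Jhom JI vK vQ (d := d + (k * e j)%N%:Z)).
- by lia.
- by move=> T; apply: IM.
- move=> T; have -> : wt (d + (k * e j)%N%:Z) l T = (k * e j)%N%:Z + wt d l T.
    by rewrite /wt; lia.
  by apply: grzM => //; exact: (grX grP k (x_homog j)).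
- by move=> T; rewrite koszul_dZ; apply: JM.
- by under [fun T => x j * _]eq_fun do rewrite mulrA -exprS.
Qed.

Hypothesis x_gen : ideal_gen (range x) = irrelevant_ideal gr.

(** When all variables act as zero, [I / J] is a finite module over the ring of
    degree 0 elements, so it lives in bounded degrees; the components on nonempty
    [T] are localizations at elements acting as zero. *)
Lemma vanishes_of_killed I J :
  homogeneous_ideal grP I -> homogeneous_ideal grP J ->
  (forall j a, I a -> J (x j * a)) -> exists D, vanishes_from D I J.
Proof.
move=> [Iid Ih] [Jid Jh] kill; have [[_ _ IM] [J0 JD JM]] := (Iid, Jid).
have [r [y Iy]] := R_noeth Iid.
have /choice[N yN] : forall i, exists N, y i = \sum_(w < N) hcomp w (y i).
  by move=> i; exact: hcomp_sum.
have Iyi i : I (y i) by rewrite Iy; apply: sub_ideal_gen; exists i.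
exists (\max_i N i)%N%:Z => d l f Dd If gf _.
exists 1%N, (fun=> 0); split=> T; first by case: Iid.
have -> : koszul_d x (l + 1) (fun=> 0) T = 0.
  by rewrite /koszul_d big1 // => j; rewrite !mulr0.
rewrite subr0 expr1.
(* For nonempty [T] one factor of [mon T] already moves [I] into [J]. *)
have [->|[j jT]] := set_0Vmem T; last first.
  by rewrite (monD1 x jT) mulrAC mulrC; apply: JM; exact: kill.
apply: (JM); have := gf finset.set0; rewrite /wt finset.big_set0 muln0 addr0 => gf0.
have := If finset.set0; rewrite {1}Iy => -[m [b [z [yz fE]]]].
rewrite -(hcomp_id grP gf0) fE raddf_sum; apply: ideal_sum => // i _ /=.
have [k _ <-] := yz i; rewrite mulrC yN mulr_suml raddf_sum.
apply: ideal_sum => // w _ /=.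
rewrite (hcompM grP _ _ (grz_hcomp grP w _ : gr w _)).
have dw : (d - w%:Z > 0).
  have := leq_bigmax (F := N) k; have := ltn_ord w; lia.
have : ideal_gen (range x) (hcomp (d - w%:Z) (b i)).
  rewrite x_gen; apply: sub_ideal_gen.
  case: (d - w%:Z) dw (grz_hcomp grP (d - w%:Z) (b i)) => // v v0 gv.
  by exists v.
apply: (ideal_gen_min (I := [set a | J (hcomp w (y k) * a)])) => [|_ [j _ <-]].
  split=> [|a a' Ja Ja'|a a' Ja'] /=.
  - by rewrite mulr0.
  - by rewrite mulrDr; exact: JD.
  - by rewrite mulrCA; exact: JM.
by rewrite /= mulrC; apply: kill; apply: Ih; exact: Iyi.
Qed.

(** Serre vanishing, by induction on the number of variables that do not act as
    zero. Subquotients of [R] form a class of modules that is stable under the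
    kernels and cokernels of multiplication by a variable, so that the induction
    stays inside the ideals of [R]. *)
Lemma serre_vanishing m I J :
  homogeneous_ideal grP I -> homogeneous_ideal grP J -> J `<=` I ->
  (forall j : 'I_n, (m <= j)%N -> forall a, I a -> J (x j * a)) ->
  exists D, vanishes_from D I J.
Proof.
elim: m I J => [|m IH] I J Ihom Jhom JI kill.
  by apply: vanishes_of_killed => // j; exact: kill.
have [nm|mn] := leqP n m.
  apply: IH => // j mj; have := ltn_ord j; lia.
pose jm := Ordinal mn.
have [[[_ ID IM] _] [[J0 JD JM] _]] := (Ihom, Jhom).
have [D1 v1] : exists D, vanishes_from D (annihilated_by jm I J) J.
  apply: IH => //; first exact: annihilated_homog.
    by move=> a Ja; split; [exact: JI|exact: JM].
  move=> j mj a [Ia Ja]; have [->//|jjm] := eqVneq j jm.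
  by apply: kill => //; move: jjm; rewrite -val_eqE /=; lia.
have [D2 v2] : exists D, vanishes_from D I (quotient_by jm I J).
  apply: IH => //; first exact: quotient_homog.
    by move=> _ [b [c [Jb Ic ->]]]; apply: ID; [exact: JI|exact: IM].
  move=> j mj a Ia; have [->|jjm] := eqVneq j jm.
    by exists 0, a; split=> //; rewrite add0r.
  exists (x j * a), 0; split; last by rewrite mulr0 addr0.
    by apply: kill => //; move: jjm; rewrite -val_eqE /=; lia.
  by case: Ihom => -[].
exists (Num.max D1 D2); apply: (vanishes_of_mul (j := jm)) => //.
  by move=> d l f Dd; apply: v1; move: Dd; rewrite ge_max => /andP[].
by move=> d l f Dd; apply: v2; move: Dd; rewrite ge_max => /andP[].
Qed.

End Vanishing.

(** * Fractions and Čech cochains *)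

Section Fractions.
Local Open Scope quotient_scope.
Variables (A : comPzRingType) (S : set A).
Local Notation "a // s" := (locfrac S a s) (at level 40).

Lemma submon_gen a : S a -> submon S a.
Proof.
by move=> Sa; exists [:: a]; rewrite big_seq1; split=> // y; rewrite inE => /eqP->.
Qed.

Lemma submon_prod (T : finType) (P : pred T) (f : T -> A) :
  (forall i, P i -> submon S (f i)) -> submon S (\prod_(i | P i) f i).
Proof. by move=> Sf; apply: big_ind => //; [exact: submon1|exact: submonM]. Qed.

Lemma submonX a q : submon S a -> submon S (a ^+ q).
Proof.
by move=> Sa; elim: q => [|q IH]; [exact: submon1|rewrite exprS; exact: submonM].
Qed.

Lemma locfracE a s (Ss : submon S s) : a // s = \pi_(loc S) (a, mkdenom Ss).
Proof.
rewrite /locfrac; case: pselect => // Ss'.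
by congr (\pi_(loc S) (_, _)); exact: val_inj.
Qed.

Lemma locfrac_eq a b s t : submon S s -> submon S t ->
  a // s = b // t <-> exists2 w, submon S w & w * (a * t) = w * (b * s).
Proof.
move=> Ss St; rewrite (locfracE _ Ss) (locfracE _ St).
split=> [/eqmodP/asboolP[w [Sw e]]|[w Sw e]]; first by exists w.
by apply: fraceqP; exists w.
Qed.

Lemma locfrac_eq1 a b s t : submon S s -> submon S t ->
  a * t = b * s -> a // s = b // t.
Proof.
by move=> Ss St e; apply/locfrac_eq => //; exists 1; [exact: submon1|rewrite e].
Qed.

Lemma locfracP (u : loc S) : exists a s, submon S s /\ u = a // s.
Proof.
exists (repr u).1, (sval (repr u).2).
split; first exact: denomP.
rewrite (locfracE _ (denomP _)) -[u in LHS]reprK; case: (repr u) => a s /=.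
by congr (\pi_(loc S) (_, _)); exact: val_inj.
Qed.

Lemma locfracD a b s t : submon S s -> submon S t ->
  a // s + b // t = (a * t + b * s) // (s * t).
Proof.
move=> Ss St; have Sst := submonM Ss St.
rewrite (locfracE _ Ss) (locfracE _ St) (locfracE _ Sst).
rewrite [LHS](esym (pi_locD _ _)).
by congr (\pi_(loc S) (_, _)); exact: val_inj.
Qed.

Lemma locfracN a s : submon S s -> - (a // s) = (- a) // s.
Proof.
by move=> Ss; rewrite !(locfracE _ Ss) [LHS](esym (pi_locN _)).
Qed.

Lemma locfracM a b s t : submon S s -> submon S t ->
  a // s * (b // t) = (a * b) // (s * t).
Proof.
move=> Ss St; have Sst := submonM Ss St.
rewrite (locfracE _ Ss) (locfracE _ St) (locfracE _ Sst).
rewrite [LHS](esym (pi_locM _ _)).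
by congr (\pi_(loc S) (_, _)); exact: val_inj.
Qed.

Lemma locfrac1 : 1 // 1 = 1.
Proof.
rewrite (locfracE _ (submon1 S)).
by congr (\pi_(loc S) (_, _)); exact: val_inj.
Qed.

Lemma locfracB a b s : (a - b) // s = a // s - b // s.
Proof.
have [Ss|nSs] := pselect (submon S s); last first.
  by rewrite /locfrac; case: pselect => // _; rewrite subrr.
rewrite locfracN // locfracD //; apply: locfrac_eq1 => //; first exact: submonM.
by ring.
Qed.

Lemma locfrac0 s : 0 // s = 0.
Proof. by rewrite -[X in X // s](subrr 0) locfracB subrr. Qed.

Lemma locfrac_sum (T : finType) (P : pred T) (f : T -> A) s :
  (\sum_(i | P i) f i) // s = \sum_(i | P i) (f i // s).
Proof.
apply: (big_morph (fun a => a // s)); last exact: locfrac0.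
by move=> a b; apply/eqP; rewrite -subr_eq -locfracB addrK.
Qed.

Lemma locfrac_sign a s k : ((-1) ^+ k * a) // s = (-1) ^+ k * (a // s).
Proof.
rewrite -!(signr_odd _ k); case: odd; rewrite ?mul1r // !mulN1r.
by rewrite -sub0r locfracB locfrac0 sub0r.
Qed.

Lemma locfracX a s q : submon S s -> (a // s) ^+ q = (a ^+ q) // (s ^+ q).
Proof.
move=> Ss; elim: q => [|q IH]; first by rewrite !expr0 locfrac1.
by rewrite !exprS IH locfracM //; exact: submonX.
Qed.

Lemma locfrac_mul2l a s t : submon S s -> submon S t -> (t * a) // (t * s) = a // s.
Proof.
by move=> Ss St; apply: locfrac_eq1 => //; [exact: submonM|ring].
Qed.

End Fractions.

Lemma submonS (A : comPzRingType) (S T : set A) : S `<=` T -> submon S `<=` submon T.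
Proof. by move=> ST a [s [Ss ->]]; exists s; split=> // y /Ss/ST. Qed.

Lemma loc_map_frac (A : comPzRingType) (S T : set A) a s : S `<=` T ->
  submon S s -> loc_map T (locfrac S a s) = locfrac T a s.
Proof.
move=> ST Ss; have ST' := submonS ST; rewrite /loc_map.
have := reprK (locfrac S a s); case: (repr _) => b t e.
have Tt := ST' _ (denomP t); apply/locfrac_eq; rewrite ?Tt //; first exact: ST'.
move: e; rewrite (locfracE _ Ss) => /eqmodP/asboolP[w [Sw e]].
by exists w; [exact: ST'|].
Qed.

Lemma common_level (T : finType) (P : T -> nat -> Prop) :
  (forall i, exists k, P i k) ->
  (forall i k k', (k <= k')%N -> P i k -> P i k') -> exists k, forall i, P i k.
Proof.
move=> /choice[k Pk] mono; exists (\max_i k i)%N => i.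
by apply: mono (Pk i); exact: leq_bigmax.
Qed.

Section CechKoszul.
Variables (R : comNzRingType) (n : nat) (x : 'I_n -> R).
Local Notation mon := (mon x).
Local Notation dens := (dens x).
Implicit Types (T : {set 'I_n}) (c : cochain x) (f : {set 'I_n} -> R).

Definition cech_of l f : cochain x :=
  fun T => locfrac (dens T) (f T) (mon T ^+ l).

Lemma submon_mon T l : submon (dens T) (mon T ^+ l).
Proof.
by apply/submonX/submon_prod => j jT; apply: submon_gen; exists j.
Qed.

Lemma submon_dvd T s : submon (dens T) s -> exists l t, t * s = mon T ^+ l.
Proof.
move=> [ss [Sss ->]]; elim: ss Sss => [|y ss IH] Sss.
  by exists 0%N, 1; rewrite big_nil mulr1.
have [|l [t et]] := IH; first by move=> z zs; apply: Sss; rewrite inE zs orbT.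
have [j /= jT yE] : dens T y by apply: Sss; rewrite inE eqxx.
exists l.+1, (mon (T :\ j)%SET * t).
by rewrite big_cons exprS -et (monD1 x jT) -yE; ring.
Qed.

Lemma cech_of_shift l s f :
  cech_of (l + s) (fun T => mon T ^+ s * f T) = cech_of l f :> (forall T, _).
Proof.
apply/functional_extensionality_dep => T; rewrite /cech_of addnC exprD.
by apply: locfrac_mul2l; exact: submon_mon.
Qed.

Lemma cech_d_of l f T :
  cech_d (cech_of l f) T = locfrac (dens T) (koszul_d x l f T) (mon T ^+ l).
Proof.
rewrite locfrac_sum; apply: eq_bigr => j jT; rewrite /sgn locfrac_sign; congr (_ * _).
have SS : dens (T :\ j)%SET `<=` dens T.
  by move=> _ [k /= + <-]; rewrite in_setD1 => /andP[_ kT]; exists k.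
rewrite loc_map_frac //; last exact: submon_mon.
rewrite (monD1 x jT) exprMn locfrac_mul2l //.
  by apply: submonS SS _ _; exact: submon_mon.
by apply: submonX; apply: submon_gen; exists j.
Qed.

(** A primitive of a cochain of Čech degree [i] may be truncated to Čech degree
    [i - 1], since the differential raises that degree by one. *)
Lemma coboundary_of_exact i l f : in_degree i (cech_of l f) ->
  stably_exact x setT [set 0] l f -> coboundary i (cech_of l f).
Proof.
move=> degf [s [g [_ Jg]]].
pose g' T := if #|T|%:Z == i - 1 then g T else 0.
exists (cech_of (l + s) g'); split=> [T /negbTE Ti|T].
  by rewrite /cech_of /g' Ti locfrac0.
rewrite cech_d_of -(cech_of_shift l s) /cech_of.
have card1 j : j \in T -> (#|(T :\ j)%SET|%:Z == i - 1) = (#|T|%:Z == i).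
  by move=> jT; rewrite (cardsD1 j T) jT; apply/eqP/eqP; lia.
have [Ti|Ti] := eqVneq #|T|%:Z i; last first.
  have := degf _ Ti; rewrite -(cech_of_shift l s) /cech_of => ->.
  rewrite /koszul_d big1 ?locfrac0 // => j jT.
  by rewrite /g' card1 // (negbTE Ti) !mulr0.
congr locfrac; have /eqP := Jg T; rewrite subr_eq0 => /eqP ->.
by apply: eq_bigr => j jT; rewrite /g' card1 // Ti eqxx.
Qed.

End CechKoszul.

Section CechGraded.
Variables (R : comNzRingType) (gr : nat -> set R).
Hypotheses (grP : is_grading gr).
Variables (n : nat) (x : 'I_n -> R) (e : 'I_n -> nat).
Hypothesis x_homog : forall j, gr (e j) (x j).
Local Notation mon := (mon x).
Local Notation dens := (dens x).
Implicit Types (T : {set 'I_n}) (c : cochain x).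

Lemma homogeneous_fraction d T (u : loc (dens T)) : loc_homogeneous gr d u ->
  exists l a, grz gr (wt e d l T) a /\ u = locfrac (dens T) a (mon T ^+ l).
Proof.
move=> [k [a [s [Ss gs ga ->]]]]; have [l [t ts]] := submon_dvd Ss.
(* Both [s] and the power of [mon T] are homogeneous, so the cofactor [t] can be
   replaced by its component in the difference of the degrees. *)
pose t' := hcomp grP ((l * \sum_(j in T) e j)%N%:Z - k%:Z) t.
have t's : t' * s = mon T ^+ l.
  rewrite -(@hcomp_id _ _ grP (l * \sum_(j in T) e j)%N (mon T ^+ l)).
    by rewrite -ts [t * s]mulrC (hcompM grP _ _ gs) mulrC.
  exact: (gr_mon grP x_homog).
exists l, (t' * a); split; last first.
  apply: locfrac_eq1 => //; first exact: submon_mon.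
  by rewrite -t's; ring.
have -> : wt e d l T = ((l * \sum_(j in T) e j)%N%:Z - k%:Z) + (d + k%:Z).
  by rewrite /wt; ring.
by apply: grzM => //; exact: grz_hcomp.
Qed.

(** Finitely many fractions are involved, so one level [l] serves all of them and
    also makes the cocycle condition hold in [R] rather than after localizing. *)
Lemma homogeneous_cocycle i d c : cocycle i c ->
  (forall T, loc_homogeneous gr d (c T)) ->
  exists l f, [/\ c = cech_of x l f, forall T, grz gr (wt e d l T) (f T)
    & forall T, koszul_d x l f T = 0].
Proof.
move=> [degc dc] homc.
have [l] : exists l, forall T, exists a, grz gr (wt e d l T) a /\
    c T = locfrac (dens T) a (mon T ^+ l).
  apply: common_level => [T|T l l' ll' [a [ga ->]]].
    exact: homogeneous_fraction.
  exists (mon T ^+ (l' - l) * a); split.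
    by rewrite -(subnKC ll') addKn; apply: grz_mon.
  rewrite -{2}(subnK ll') exprD locfrac_mul2l //; exact: submon_mon.
move=> /choice[f /all_and2[gf cf]].
have {cf} cE : c = cech_of x l f by apply/functional_extensionality_dep.
have [s ds] : exists s, forall T, mon T ^+ s * koszul_d x l f T = 0.
  apply: common_level => [T|T s s' ss' ds]; last first.
    by rewrite -(subnK ss') exprD -mulrA ds mulr0.
  have := dc T; rewrite cE cech_d_of -(locfrac0 _ (mon T ^+ l)).
  move=> /locfrac_eq[||w Sw]; try exact: submon_mon.
  rewrite mul0r mulr0 => wd; have [m [t tw]] := submon_dvd Sw.
  exists (m + l)%N; rewrite exprD -tw -[RHS](mulr0 t) -wd; ring.
exists (l + s)%N, (fun T => mon T ^+ s * f T); split.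
- by rewrite cech_of_shift.
- by move=> T; apply: grz_mon.
- by move=> T; rewrite koszul_d_shift.
Qed.

End CechGraded.

(** * Splittings of Frobenius *)

Lemma common_denominator (A : comPzRingType) (S : set A) (T : finType)
    (P : T -> A -> Prop) :
  (forall i, exists2 s, submon S s & P i s) ->
  (forall i s t, submon S s -> submon S t -> P i s -> P i (t * s)) ->
  exists2 s, submon S s & forall i, P i s.
Proof.
move=> h mono.
have /choice[s /all_and2[Ss Ps]] : forall i, exists s, submon S s /\ P i s.
  by move=> i; have [s Ss Ps] := h i; exists s.
exists (\prod_i s i) => [|i]; first by apply: submon_prod.
by rewrite (bigD1 i) //= mulrC; apply: mono => //; exact: submon_prod.
Qed.

Section FrobeniusKoszul.
Variables (R : comNzRingType) (n : nat) (x : 'I_n -> R) (p : nat).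
Hypothesis pR : p \in [pchar R].
Implicit Types (T : {set 'I_n}) (f : {set 'I_n} -> R).

Lemma pnat_Frobenius q : [pchar R].-nat (p ^ q)%N.
Proof.
rewrite (eq_pnat _ (pcharf_eq pR)) pnatX pnat_id //; exact: pcharf_prime pR.
Qed.

Lemma koszul_d_Frobenius e l f T :
  koszul_d x (l * p ^ e) (fun T => f T ^+ (p ^ e)) T = koszul_d x l f T ^+ (p ^ e).
Proof.
have q0 : (p ^ e != 0)%N by rewrite -lt0n expn_gt0 prime_gt0 // (pcharf_prime pR).
have qE := pnat_Frobenius e.
rewrite /koszul_d [RHS](big_morph (fun a => a ^+ (p ^ e))
  (id1 := 0) (op1 := +%R)); first last.
- by rewrite expr0n (negbTE q0).
- by move=> a b; exact: exprDn_pchar.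
apply: eq_bigr => j jT; rewrite !exprMn (exprM (x j)); congr (_ * _).
rewrite /sgn -(signr_odd _ #|_|); case: odd; last by rewrite [_ ^+ false]expr0 expr1n.
by rewrite [_ ^+ true]expr1 exprNn_pchar // expr1n.
Qed.

End FrobeniusKoszul.

Section SplittingDescent.
Variables (R : comNzRingType) (n : nat) (x : 'I_n -> R) (S : set R).
Implicit Types (T : {set 'I_n}) (f : {set 'I_n} -> R).

(** A splitting of [1 |-> F_* (a / s)] over the localization, applied to the
    equations that make [a f ^+ q] a coboundary, shows that [f] becomes a
    coboundary over the localization. Only finitely many elements are
    involved, so clearing denominators brings this back to [R]. *)
Lemma exact_of_splitting q (phi : {additive loc S -> loc S}) a s l f :
  (0 < q)%N -> submon S s -> (forall r y, phi (r ^+ q * y) = r * phi y) ->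
  phi (locfrac S a s) = 1 ->
  stably_exact x setT [set 0] (l * q) (fun T => a * f T ^+ q) ->
  exists2 u, submon S u & stably_exact x setT [set 0] l (fun T => u * f T).
Proof.
move=> q0 Ss phiM phi1 [m [g [_ Jg]]].
pose psi y := phi (locfrac S y s).
have S1 := submon1 S.
have psiM r y : psi (r ^+ q * y) = locfrac S r 1 * psi y.
  by rewrite /psi -phiM locfracX // locfracM ?expr1n ?mul1r.
(* Raising the level from [l * q + m] to [(l + m) * q] makes every coefficient of
   the differential a [q]-th power, which [psi] can take out. *)
pose L := (l + m)%N.
pose G T := mon x T ^+ (m * q.-1) * g T.
have eqG T : (mon x T ^+ m * f T) ^+ q * a = koszul_d x (L * q) G T.
  have := Jg T; move/eqP; rewrite subr_eq0 => /eqP e.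
  have -> : (L * q = l * q + m + m * q.-1)%N.
    by rewrite /L; case: q q0 {phiM psiM G e Jg} => // q _; lia.
  rewrite koszul_d_shift -e exprMn -exprM.
  have -> : (m * q = m * q.-1 + m)%N.
    by case: q q0 {phiM psiM G e Jg} => // q _; lia.
  by rewrite exprD; ring.
have [v Sv] : exists2 v, submon S v & forall T, exists b, psi (G T) = locfrac S b v.
  apply: common_denominator => [T|T u t Su St [b ->]].
    by have [b [u [Su e]]] := locfracP (psi (G T)); exists u => //; exists b.
  by exists (t * b); rewrite locfrac_mul2l.
move=> /choice[b psib].
have eqv T : locfrac S (mon x T ^+ m * f T) 1 = locfrac S (koszul_d x L b T) v.
  have -> : locfrac S (mon x T ^+ m * f T) 1 = psi ((mon x T ^+ m * f T) ^+ q * a).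
    by rewrite psiM /psi phi1 mulr1.
  rewrite eqG /psi /koszul_d !locfrac_sum raddf_sum; apply: eq_bigr => j jT.
  rewrite /sgn !locfrac_sign raddfMsign; congr (_ * _).
  rewrite exprM -/(psi _) psiM psib locfracM // mul1r //.
have [w Sw eqw] : exists2 w, submon S w & forall T,
    w * (mon x T ^+ m * f T * v) = w * koszul_d x L b T.
  apply: common_denominator => [T|T u t Su St e]; last by rewrite -[LHS]mulrA -[RHS]mulrA e.
  have /locfrac_eq[||w Sw e] := eqv T => //.
  by exists w; rewrite // e mulr1.
exists (w * v); first exact: submonM.
exists m, (fun T => w * b T); split=> // T.
by rewrite koszul_dZ -eqw /=; ring.
Qed.

End SplittingDescent.

(** * Localization at the irrelevant ideal *)

Section Irrelevant.
Variables (R : comNzRingType) (gr : nat -> set R) (k : fieldType).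
Variable iota : {rmorphism k -> R}.
Hypotheses (grP : is_grading gr) (R0E : gr 0%N = range iota).
Local Notation hcomp := (hcomp grP).
Local Notation m := (irrelevant_ideal gr).

Lemma hcomp0_scalar a : exists c, hcomp 0 a = iota c.
Proof.
by have : gr 0%N (hcomp 0 a) := grz_hcomp grP 0 a; rewrite R0E => -[c _ <-]; exists c.
Qed.

Lemma irrelevantP a : m a <-> hcomp 0 a = 0.
Proof. by rewrite (irrelevant_idealE grP); split=> [|a0 [|]//]; apply. Qed.

Lemma hcomp0_1 : hcomp 0 1 = 1.
Proof. by apply: hcomp_id; exact: grz1. Qed.

Lemma irrelevant_maximal : is_maximal m.
Proof.
split=> [||J [J0 JD JM] J1 mJ a Ja].
- rewrite (irrelevant_idealE grP); exact: order_ge_ideal.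
- by move/irrelevantP; rewrite hcomp0_1; apply/eqP/oner_neq0.
apply/irrelevantP; have [c ac] := hcomp0_scalar a; rewrite ac.
have [->|c0] := eqVneq c 0; first exact: rmorph0.
case: J1; suff Jc : J (iota c).
  by rewrite -(rmorph1 iota) -(mulVf c0) rmorphM; exact: JM.
have -> : iota c = a + (-1) * (a - iota c) by ring.
apply: JD => //; apply/JM/mJ/irrelevantP; rewrite raddfB /= ac hcomp_id ?subrr //.
by rewrite /= R0E; exists c.
Qed.

Lemma submon_unit u : submon (~` m) u -> exists2 c, c != 0 & hcomp 0 u = iota c.
Proof.
move=> [s [Ss ->]]; elim: s Ss => [|y s IH] Ss.
  by exists 1; rewrite ?oner_neq0 // big_nil rmorph1 hcomp0_1.
have [|c c0 sc] := IH; first by move=> z zs; apply: Ss; rewrite inE zs orbT.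
have [b yb] := hcomp0_scalar y.
exists (b * c); last by rewrite big_cons hcomp0M sc yb rmorphM.
rewrite mulf_neq0 //; apply/eqP => b0.
by apply: (Ss y); rewrite ?inE ?eqxx //; apply/irrelevantP; rewrite yb b0 rmorph0.
Qed.

Lemma loc_irrelevant_pow N u : ideal_pow (loc_ideal R (~` m) m) N u ->
  exists a s, [/\ order_ge grP N a, submon (~` m) s & u = locfrac (~` m) a s].
Proof.
pose Q N := [set u : loc (~` m) | exists a s,
  [/\ order_ge grP N a, submon (~` m) s & u = locfrac (~` m) a s]].
have QM M M' v v' : Q M v -> Q M' v' -> Q (M + M')%N (v * v').
  move=> [a [s [aM Ss ->]]] [a' [s' [aM' Ss' ->]]].
  exists (a * a'), (s * s'); split; [exact: order_geM|exact: submonM|].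
  exact: locfracM.
have Qid M : is_ideal (Q M).
  have [I0 ID IM] := order_ge_ideal grP M.
  split=> [|v v' [a [s [aM Ss ->]]] [a' [s' [aM' Ss' ->]]]|v v' Qv'].
  - by exists 0, 1; split; [|exact: submon1|rewrite locfrac0].
  - exists (a * s' + a' * s), (s * s'); split; [|exact: submonM|exact: locfracD].
    by apply: ID; rewrite mulrC; exact: IM.
  - apply: (QM 0%N) => //; have [a [s [Ss ->]]] := locfracP v.
    by exists a, s.
apply: (ideal_gen_min (Qid N)) => _ [y [Iy ->]].
have Q1 v : loc_ideal R (~` m) m v -> Q 1%N v.
  apply: (ideal_gen_min (Qid 1%N)) => _ [a ma <-].
  exists a, 1; split=> //; last exact: submon1.
  by rewrite -irrelevant_idealE.
elim: N y Iy => [|N IH] y Iy.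
  rewrite big_ord0 -locfrac1; exists 1, 1; split=> //; exact: submon1.
rewrite big_ord_recl; apply: (QM 1%N N); first exact: Q1.
by apply: IH => i; exact: Iy.
Qed.

Variables (n : nat) (x : 'I_n -> R) (e : 'I_n -> nat).
Hypothesis x_homog : forall j, gr (e j) (x j).

(** Denominators prime to the irrelevant ideal have an invertible component of
    degree 0, and a homogeneous class sees only this component. *)
Lemma exact_of_unit d l f u : submon (~` m) u ->
  (forall T, grz gr (wt e d l T) (f T)) ->
  stably_exact x setT [set 0] l (fun T => u * f T) -> stably_exact x setT [set 0] l f.
Proof.
move=> Su gf [s [g [_ Jg]]]; have [c c0 uc] := submon_unit Su.
pose h := cochain_hcomp grP e d (l + s) g.
exists s, (fun T => iota c^-1 * h T); split=> // T.
have := Jg T => /(congr1 (hcomp (wt e d (l + s) T))).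
rewrite raddfB raddf0 /= (hcomp_koszul_d grP x_homog) -/h.
have gm : grz gr (wt e d (l + s) T) (mon x T ^+ s * f T).
  exact: (grz_mon grP x_homog).
rewrite mulrA mulrAC (hcompMz grP _ _ gm) subrr uc koszul_dZ => /eqP.
rewrite subr_eq0 => /eqP <-; rewrite /= mulrCA -rmorphM mulVf // rmorph1.
by rewrite mulr1 subrr.
Qed.

End Irrelevant.

(** * Degrees under Frobenius *)

Section DegreeGrowth.
Variables (K : realType) (p : nat).
Hypothesis p1 : (1 < p)%N.

(** If [t > - d], then [t (q - 1) + q d] grows like [(t + d) q]: the gain of degree
    by multiplication outweighs the multiplication of [d] by [q]. *)
Lemma degree_growth (t : K) (d D : int) : 0 < t + d%:~R ->
  exists e0, forall e N : nat, (e0 <= e)%N ->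
    t * (p ^ e - 1)%N%:R - 1 <= N%:R -> D <= N%:Z + d * (p ^ e)%N%:Z.
Proof.
move=> td; pose B := ((D - d + 1)%:~R : K) / (t + d%:~R).
exists `|Num.ceil B|%N => e N e0 hN.
have q1 : (e <= p ^ e - 1)%N by have := ltn_expl e p1; lia.
set q := (p ^ e - 1)%N in q1 hN.
have -> : (p ^ e)%N%:Z = q%:Z + 1 by rewrite /q; have := expn_gt0 p e; lia.
have Bq : B <= q%:R.
  apply: le_trans (ceil_ge B) _; rewrite -[q%:R]/(q%:Z%:~R) ler_int.
  by apply: le_trans (ler_norm _) _; rewrite -abszE lez_nat; exact: leq_trans q1.
rewrite -(ler_int K) rmorphD rmorphM rmorphD /=.
move: Bq; rewrite /B ler_pdivrMr // !rmorphD rmorphN /= => Bq.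
change (D%:~R <= N%:R + d%:~R * (q%:R + 1) :> K).
by move: hN Bq; rewrite mulrDr; lra.
Qed.

Lemma ceil_exp_ge (t : K) e : t * (p ^ e - 1)%N%:R - 1 <= (ceil_exp p t e)%:R.
Proof.
rewrite /ceil_exp; set y := t * _.
apply: le_trans (_ : (Num.ceil y)%:~R <= _).
  by apply: le_trans (ceil_ge y); rewrite lerBlDr lerDl.
by rewrite -[_%:R]/(_%:Z%:~R) ler_int abszE ler_norm.
Qed.

Lemma floor_exp_ge (t : K) e : t * (p ^ e - 1)%N%:R - 1 <= (floor_exp p t e)%:R.
Proof.
rewrite /floor_exp; set y := t * _.
apply: le_trans (_ : (Num.floor y)%:~R <= _).
  by rewrite lerBlDr; have := floorD1_gt y; rewrite rmorphD => /ltW.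
by rewrite -[_%:R]/(_%:Z%:~R) ler_int abszE ler_norm.
Qed.

End DegreeGrowth.

Section HighDegree.
Variables (R : comNzRingType) (gr : nat -> set R) (grP : is_grading gr).
Variables (n : nat) (x : 'I_n -> R) (e : 'I_n -> nat).
Variable p : nat.
Hypothesis pR : p \in [pchar R].

(** The degree argument: [r] has order at least [N] and Frobenius multiplies
    degrees by [p ^ q], so all homogeneous parts of [r f ^+ (p ^ q)] live in
    degrees where cohomology vanishes. *)
Lemma exact_mul_Frobenius D d l f N r q :
  vanishes_from gr x e D setT [set 0] ->
  (forall T, grz gr (wt e d l T) (f T)) -> (forall T, koszul_d x l f T = 0) ->
  order_ge grP N r -> D <= N%:Z + d * (p ^ q)%N%:Z ->
  stably_exact x setT [set 0] (l * p ^ q) (fun T => r * f T ^+ (p ^ q)).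
Proof.
move=> van gf df rN DN.
have [M ->] := hcomp_sum grP r.
elim: M => [|M IH].
  exists 0%N, (fun=> 0); split=> // T.
  by rewrite big_ord0 /koszul_d big1 ?mul0r ?mulr0 ?subrr // => j; rewrite !mulr0.
under [fun T => _]eq_fun do rewrite big_ord_recr mulrDl.
apply: exactD => /=; [exact: ideal_full|exact: ideal_zero|exact: IH|].
have [MN|NM] := ltnP M N.
  exists 0%N, (fun=> 0); split=> // T.
  by rewrite rN // /koszul_d big1 ?mul0r ?mulr0 ?subrr // => j; rewrite !mulr0.
apply: (van (M%:Z + d * (p ^ q)%N%:Z)) => // [|T|T]; first by lia.
  have -> : wt e (M%:Z + d * (p ^ q)%N%:Z) (l * p ^ q) T =
      M%:Z + wt e d l T *+ (p ^ q).
    by rewrite /wt -mulr_natr natz; lia.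
  by apply: grzM => //; [exact: grz_hcomp|exact: grzX].
rewrite /= koszul_dZ koszul_d_Frobenius // df expr0n.
rewrite -[X in X == _]/((p ^ q)%N) expn_eq0 eqn0Ngt.
by rewrite prime_gt0 ?(pcharf_prime pR) // mulr0.
Qed.

End HighDegree.

Theorem proposition3p5 (K : realType) (p : nat)
    (R : comNzRingType) (gr : nat -> set R)
    (R_noeth : noetherian R) (R_graded : is_grading gr)
    (k : fieldType) (iota : {rmorphism k -> R}) (R0E : gr 0%N = range iota)
    (k_char : p \in [pchar k]) (k_Ffin : F_finite p k)
    (R_Finj : F_injective p R)
    (n : nat) (x : 'I_n -> R)
    (x_homog : forall j, exists d, gr d (x j))
    (x_gen : ideal_gen (range x) = irrelevant_ideal gr) :
  (forall i : int, (c_inv K p x i <= - a_inv gr K x i)%E) /\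
  (F_pure p R ->
     forall i : int, (fpt K p (irrelevant_ideal gr) <= - a_inv gr K x i)%E).
Proof.
have pR : p \in [pchar R] := rmorph_pchar iota k_char.
have p_prime := pcharf_prime pR; have p1 := prime_gt1 p_prime.
have /choice[e x_gr] := x_homog.
have homT : homogeneous_ideal R_graded setT by split; [exact: ideal_full|].
have homZ : homogeneous_ideal R_graded [set 0].
  split; first exact: ideal_zero.
  by move=> d a ->; rewrite /= raddf0.
have [D van] : exists D, vanishes_from gr x e D setT [set 0].
  apply: (@serre_vanishing _ _ R_graded R_noeth n x e x_gr x_gen n) => //.
  by move=> j; rewrite leqNgt ltn_ord.
(* Both inequalities say that no admissible [t] exceeds [- d] when there is a
   class in degree [d]. *)
have bound (X : set K) i :
    (forall t d, X t -> cohomology_nonzero gr x i d -> t <= - d%:~R) ->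
    (ereal_sup [set t%:E | t in X] <= - a_inv gr K x i)%E.
  move=> h; apply: ge_ereal_sup => _ [t Xt <-]; rewrite leeNr.
  apply: ge_ereal_sup => _ [d Hd <-].
  by rewrite -EFinN lee_fin lerNr; exact: h.
split=> [i|_ i]; apply: bound => t d [t0 ht] [c [cz homc ncob]];
  rewrite leNgt; apply/negP; rewrite ltrNl -subr_gt0 opprK addrC => td;
  have [l [f [cE gf df]]] := homogeneous_cocycle R_graded x_gr cz homc;
  have [e0 he0] := degree_growth p1 D td.
(* For [t > - d] the class [c] lies in the submodule attached to [t], which
   is zero. *)
- have degF r q : in_degree i (cochain_scale r (cochain_frob p q c)).
    move=> T Ti; rewrite /cochain_scale /cochain_frob.
    have -> : c T = 0 by case: cz => + _; exact.
    rewrite expr0n -[X in X == _]/((p ^ q)%N) expn_eq0 eqn0Ngt.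
    by rewrite prime_gt0 // mulr0.
  apply: ncob; apply: ht => //; exists e0 => q e0q r rN.
  have scaleE : cochain_scale r (cochain_frob p q c) =
      cech_of x (l * p ^ q) (fun T => r * f T ^+ (p ^ q)).
    apply/functional_extensionality_dep => T.
    rewrite /cochain_scale /cochain_frob cE /cech_of.
    rewrite locfracX; last exact: submon_mon.
    rewrite -exprM locfracM ?mul1r //; first exact: submon1.
    exact: submon_mon.
  have := degF r q; rewrite scaleE => degE.
  apply: coboundary_of_exact => //.
  apply: (exact_mul_Frobenius (grP := R_graded) pR van gf df (N := ceil_exp p t q)).
    by apply: irrelevant_pow; rewrite -x_gen.
  by apply: he0 => //; exact: ceil_exp_ge.
(* The multiple of the Frobenius image of [c] by the splitting element
   vanishes for degree reasons, whereas the splitting recovers [c] from it. *)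
- have [q e0q [u upow [phi [phiM phi1]]]] :=
    ht _ (irrelevant_maximal R_graded R0E) e0.
  have [a [s [aN Ss uE]]] := loc_irrelevant_pow R_graded upow.
  rewrite uE in phi1.
  have degc : in_degree i (cech_of x l f) by rewrite -cE; case: cz.
  apply: ncob; rewrite cE; apply: coboundary_of_exact => //.
  have q0 : (0 < p ^ q)%N by rewrite expn_gt0 prime_gt0.
  have cob := exact_mul_Frobenius pR van gf df aN
    (he0 _ _ e0q (floor_exp_ge p t q)).
  have [v Sv vf] := exact_of_splitting q0 Ss phiM phi1 cob.
  exact: (exact_of_unit R_graded R0E x_gr Sv gf vf).
Qed.
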